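(* For every instance $I=\langle ((x_1,y_1),b_1),\dots,((x_n,y_n),b_n)\rangle$ in $\mathbb{R}^2$ with the $L_1$ distance, the social cost of the location $\mathrm{med}^+$ output by the 2D-Median-Plus mechanism is at most the social cost of the location $\mathrm{med}$ output by the Median algorithm: $SC(\mathrm{med}^+,I)\le SC(\mathrm{med},I)$.
   Context: An instance with $n\ge1$ agents is $I=\langle ((x_1,y_1),b_1),\dots,((x_n,y_n),b_n)\rangle$, with locations $(x_i,y_i)\in\mathbb{R}^2$ and preferred distances $b_i\in[0,B]$. The cost of agent $i$ for a facility at $z=(z_1,z_2)$ is $cost(z,((x_i,y_i),b_i))=\big|\,|x_i-z_1|+|y_i-z_2|-b_i\,\big|$; the social cost is $SC(z,I)=\sum_i cost(z,((x_i,y_i),b_i))$. The median of $n$ numbers is the one of rank $\lfloor (n+1)/2\rfloor$ in increasing order. The Median algorithm outputs $\mathrm{med}=(\mathrm{med}_x,\mathrm{med}_y)$, where $\mathrm{med}_x$ is the median of $x_1,\dots,x_n$ and $\mathrm{med}_y$ the median of $y_1,\dots,y_n$. Vertical extended half diamond (v-EHD) of agent $i$: the right half (if $x_i\le\mathrm{med}_x$) or left half (otherwise) of the boundary of the $L_1$ ball of radius $b_i$ about $(x_i,y_i)$, extended vertically to $y=\pm\infty$ along the line $x=x_i$. Equivalently it is the set of points $(v_i(y),y)$, $y\in\mathbb{R}$, with $v_i(y)=x_i+\max(b_i-|y-y_i|,0)$ if $x_i\le\mathrm{med}_x$ and $v_i(y)=x_i-\max(b_i-|y-y_i|,0)$ otherwise.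 The vertical split line is the set of points $(V(y),y)$, $y\in\mathbb{R}$, where $V(y)$ is the median of $v_1(y),\dots,v_n(y)$. The horizontal extended half diamonds and horizontal split line are defined analogously with the roles of the coordinates exchanged: $h_i(x)=y_i+\max(b_i-|x-x_i|,0)$ if $y_i\le\mathrm{med}_y$ and $h_i(x)=y_i-\max(b_i-|x-x_i|,0)$ otherwise; $H(x)$ is the median of $h_1(x),\dots,h_n(x)$; the horizontal split line is $\{(x,H(x)):x\in\mathbb{R}\}$. 2D-Median-Plus mechanism: compute both split lines. Their intersection is either a single point or a single line segment of slope $\pm1$. Output as $\mathrm{med}^+$ the intersection point; if there are multiple intersection points, output the one of lowest social cost, and if there are several of these, the one nearest to $\mathrm{med}$. *)

(* Defs.v *)
From mathcomp Require Import all_boot all_order all_algebra.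
From mathcomp Require Import all_classical all_reals all_analysis.
From mathcomp Require Import ring lra zify.

Set Implicit Arguments.
Unset Strict Implicit.
Unset Printing Implicit Defensive.

Import Order.TTheory GRing.Theory Num.Theory.
Import numFieldNormedType.Exports.

Local Open Scope classical_set_scope.
Local Open Scope ring_scope.

(* [I i = ((x_i, y_i), b_i)]: location and preferred distance of agent i. *)
Definition instance (R : realType) (n : nat) := 'I_n -> (R * R) * R.

Section Mechanism.
Context {R : realType} {n : nat}.

Definition dist1 (p q : R * R) : R := `|p.1 - q.1| + `|p.2 - q.2|.

(* Rank (n + 1) / 2 is counted from 1, hence the predecessor in the index;
   the default value of [nth] is only reached when n = 0. *)
Definition median (f : 'I_n -> R) : R :=
  nth 0 (sort <=%R (codom f)) (n.+1)./2.-1.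

Variable I : instance R n.

Definition loc_x (i : 'I_n) : R := (I i).1.1.
Definition loc_y (i : 'I_n) : R := (I i).1.2.
Definition pref (i : 'I_n) : R := (I i).2.

Definition cost (z : R * R) (i : 'I_n) : R :=
  `| dist1 (loc_x i, loc_y i) z - pref i |.

Definition SC (z : R * R) : R := \sum_(i < n) cost z i.

Definition med : R * R := (median loc_x, median loc_y).

(* The vertical extended half diamond of agent i is the set of points
   (vEHD i y, y): the half of the L1 sphere of radius b_i about (x_i, y_i) that
   faces med_x, continued along x = x_i outside |y - y_i| <= b_i. *)
Definition vEHD (i : 'I_n) (y : R) : R :=
  let w := Num.max (pref i - `|y - loc_y i|) 0 in
  if loc_x i <= med.1 then loc_x i + w else loc_x i - w.

Definition hEHD (i : 'I_n) (x : R) : R :=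
  let w := Num.max (pref i - `|x - loc_x i|) 0 in
  if loc_y i <= med.2 then loc_y i + w else loc_y i - w.

Definition vsplit_line : set (R * R) :=
  range (fun y : R => (median (fun i => vEHD i y), y)).

Definition hsplit_line : set (R * R) :=
  range (fun x : R => (x, median (fun i => hEHD i x))).

(* z is a possible output of the 2D-Median-Plus mechanism: an intersection
   point of the split lines, of least social cost among these, and, among the
   intersection points of that social cost, nearest to med in L1 distance.
   The rule may leave ties, so it is a relation; see med_plus_exists for
   the existence of an output. *)
Definition is_med_plus (z : R * R) : Prop :=
  let S := vsplit_line `&` hsplit_line in
  [/\ S z,
      forall w, S w -> SC z <= SC w &
      forall w, S w -> SC w = SC z -> dist1 z med <= dist1 w med].

End Mechanism.

Section Existence.
Context {R : realType} {n : nat}.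
Implicit Types f g : 'I_n -> R.

Let rank_lt : (0 < n)%N -> ((n.+1)./2.-1 < n)%N.
Proof. by case: n => // m _; lia. Qed.

Let medianP f c : (0 < n)%N ->
  median f <= c <-> ((n.+1)./2.-1 < count (<= c) (codom f))%N.
Proof.
move=> n0; rewrite -(count_sort <=%R) /median.
have ss : sorted <=%R (sort <=%R (codom f)) by exact: sort_le_sorted.
split=> [|/(nth_count_le 0 ss)//].
apply: contraTltn => h; rewrite -ltNge nth_count_gt// h/=.
by rewrite size_sort size_codom card_ord rank_lt.
Qed.

Let median_le f g d : (0 < n)%N -> (forall i, f i <= g i + d) ->
  median f <= median g + d.
Proof.
move=> n0 fg; apply/medianP => //.
have /medianP -/(_ n0) : median g <= median g by [].
move=> /leq_trans; apply; rewrite !count_map.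
by apply: sub_count => i /= gi; rewrite (le_trans (fg i))// lerD2r.
Qed.

Let median_lip f g d : (0 < n)%N -> (forall i, `|f i - g i| <= d) ->
  `|median f - median g| <= d.
Proof.
move=> n0 fg.
have h1 : median f <= median g + d.
  by apply: median_le => // i; have := fg i; rewrite ler_norml; lra.
have h2 : median g <= median f + d.
  by apply: median_le => // i; have := fg i; rewrite ler_norml; lra.
by rewrite ler_norml; lra.
Qed.

Let median_mem f : (0 < n)%N -> exists i, median f = f i.
Proof.
move=> n0; have : median f \in codom f.
  by rewrite -(mem_sort <=%R) mem_nth// size_sort size_codom card_ord rank_lt.
by case/codomP => i ->; exists i.
Qed.

Let lip_cont (f : R -> R) (k : R) :
  (forall s t, `|f s - f t| <= k * `|s - t|) -> continuous f.
Proof.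
move=> fk x; apply/cvgrPdist_le => e e0.
have k0 : 0 <= k.
  by have := fk 1 0; rewrite subr0 normr1 mulr1; apply: le_trans.
have d0 : 0 < e / (k + 1) by rewrite divr_gt0// ltr_wpDl.
apply: filterS (nbhsx_ballx x _ d0) => t; rewrite /ball/= => /ltW xt.
rewrite (le_trans (fk _ _))//.
rewrite (@le_trans _ _ ((k + 1) * (e / (k + 1))))//.
  by apply: ler_pM => //; lra.
by rewrite mulrCA mulfV ?mulr1//; lra.
Qed.

Variable I : instance R n.
Hypothesis n0 : (0 < n)%N.

Let V y := median (fun i => vEHD I i y).
Let H x := median (fun i => hEHD I i x).

Let max_lip (b c s t : R) :
  `|Num.max (b - `|s - c|) 0 - Num.max (b - `|t - c|) 0| <= `|s - t|.
Proof.
have := ler_normB (s - c) (t - c).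
have := ler_dist_dist (s - c) (t - c).
rewrite (_ : s - c - (t - c) = s - t); last by ring.
rewrite ler_norml => /andP[h1 h2] _.
rewrite ler_norml /Num.max; case: ifP; case: ifP; move=> /idP k1 /idP k2.
all: have := normr_ge0 (s - t); move: k1 k2; lra.
Qed.

Let V_lip s t : `|V s - V t| <= `|s - t|.
Proof.
apply: median_lip => // i; rewrite /vEHD; case: ifP => _.
  by rewrite opprD addrACA subrr add0r; exact: max_lip.
by rewrite opprB addrC addrA subrK distrC; exact: max_lip.
Qed.

Let H_lip s t : `|H s - H t| <= `|s - t|.
Proof.
apply: median_lip => // i; rewrite /hEHD; case: ifP => _.
  by rewrite opprD addrACA subrr add0r; exact: max_lip.
by rewrite opprB addrC addrA subrK distrC; exact: max_lip.
Qed.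

Let M := \sum_(i < n) (`|loc_x I i| + `|pref I i|).

Let V_bound y : - M <= V y <= M.
Proof.
rewrite /V; have [i ->] := median_mem (fun i => vEHD I i y) n0.
have : `|loc_x I i| + `|pref I i| <= M.
  by rewrite /M (bigD1 i)//= lerDl sumr_ge0// => j _; rewrite addr_ge0.
have := ler_norm (loc_x I i); have := ler_norm (- loc_x I i).
have := ler_norm (pref I i); have := normr_ge0 (pref I i).
have := normr_ge0 (y - loc_y I i); rewrite normrN /vEHD /Num.max.
by case: ifP => _; case: ifP => /idP; lra.
Qed.

Let SP x y : (vsplit_line I `&` hsplit_line I) (x, y) <-> V y = x /\ H x = y.
Proof.
split=> [[[t _ [<- <-]] [u _ [h1 h2]]]|[h1 h2]].
  by split=> //; rewrite /V -h1.
by split; [exists y => //; rewrite -h1|exists x => //; rewrite -h2].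
Qed.

Lemma med_plus_exists : exists z, is_med_plus I z.
Proof.
have VH_lip s t : `|V (H s) - V (H t)| <= `|s - t|.
  exact: le_trans (V_lip _ _) (H_lip _ _).
have g_cont : continuous (fun x => V (H x) - x).
  apply: (@lip_cont _ 2) => s t.
  have -> : V (H s) - s - (V (H t) - t) = (V (H s) - V (H t)) - (s - t).
    by ring.
  by rewrite (le_trans (ler_normB _ _))// mulr_natl mulr2n lerD2r.
have dist_lip p s t :
    `|dist1 p (s, H s) - dist1 p (t, H t)| <= 2 * `|s - t|.
  rewrite /dist1/= opprD addrACA (le_trans (ler_normD _ _))//.
  rewrite mulr_natl mulr2n lerD//.
    rewrite (le_trans (ler_dist_dist _ _))// opprB addrC addrA subrK.
    by rewrite distrC.
  rewrite (le_trans (ler_dist_dist _ _))// opprB addrC addrA subrK.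
  by rewrite distrC H_lip.
have F_cont : continuous (fun x => SC I (x, H x)).
  apply: (@lip_cont _ (2 *+ n)) => s t.
  rewrite /SC -sumrB (le_trans (ler_norm_sum _ _ _))//.
  rewrite (@le_trans _ _ (\sum_(i < n) 2 * `|s - t|))//; last first.
    by rewrite sumr_const card_ord -mulrnAl lexx.
  apply: ler_sum => i _; rewrite /cost (le_trans (ler_dist_dist _ _))//.
  by rewrite opprB addrA subrK dist_lip.
have D_cont : continuous (fun x => dist1 (x, H x) (med I)).
  apply: (@lip_cont _ 2) => s t.
  have E x : dist1 (x, H x) (med I) = dist1 (med I) (x, H x).
    by rewrite /dist1 distrC [X in _ + X]distrC.
  by rewrite !E.
have M0 : - M <= M by have := V_bound 0; lra.
pose K := `[- M, M] `&` [set x | V (H x) - x = 0].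
have KP x : K x <-> V (H x) = x.
  split=> [[_ /eqP]|E]; first by rewrite subr_eq0 => /eqP.
  by split; rewrite /= ?in_itv/= ?E ?subrr// -E V_bound.
have cK : compact K.
  apply: compact_closedI; first exact: segment_compact.
  by apply: (preimage_closed _ (@closed_eq _ 0)) => x _; exact: g_cont.
have K0 : K !=set0.
  have [] := @IVT R (fun x => V (H x) - x) (- M) M 0 M0.
  - exact: continuous_subspaceT.
  - have /andP[_ h] := V_bound (H M); have /andP[h' _] := V_bound (H (- M)).
    by rewrite ge_min le_max; apply/andP; split; apply/orP; [right|left]; lra.
  - by move=> c _ /eqP; rewrite subr_eq0 => /eqP /KP; exists c.
have [a aK amin] := compact_EVT_min K0 cK (continuous_subspaceT F_cont).
pose L := K `&` [set x | SC I (x, H x) <= SC I (a, H a)].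
have cL : compact L.
  apply: compact_closedI => //.
  by apply: (preimage_closed _ (@closed_le _ _)) => x _; exact: F_cont.
have L0 : L !=set0 by exists a; split => //=; exact: set_mem.
have [c cL' cmin] := compact_EVT_min L0 cL (continuous_subspaceT D_cont).
have [/KP Kc Fc] := set_mem cL'.
exists (c, H c); split.
- exact/SP.
- move=> [x y] /SP[+ yE]; rewrite -yE => /KP Kx.
  by rewrite (le_trans Fc)// amin// inE.
- move=> [x y] /SP[+ yE]; rewrite -yE => /KP Kx SE.
  by apply: cmin; rewrite inE; split => //=; rewrite SE.
Qed.

End Existence.

(* Main.v *)
(* Let z be an intersection point of the split lines that is nearest to med; by
   the choice of med+ it suffices that SC z <= SC med.  Reflect so that
   z = med + (a, c) with a, c >= 0.  An agent whose half diamond lies weakly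
   beyond z in a coordinate pays that coordinate's displacement when the facility
   moves from z to med, the others gain at most as much, and at least half of
   the agents are of the first kind in each coordinate.  The only exception are
   agents whose two half diamonds share an edge of slope 1 through z: they lose
   only |a - c|.  If this breaks the count, then the split lines themselves
   follow these edges from z towards med, so z was not nearest. *)

Require Import Defs.
From mathcomp Require Import all_boot all_order all_algebra.
From mathcomp Require Import all_classical all_reals all_analysis.
From mathcomp Require Import ring lra zify.

Import Order.TTheory GRing.Theory Num.Theory.
Import numFieldNormedType.Exports.
Local Open Scope classical_set_scope.
Local Open Scope ring_scope.

(** * Medians as majority votes *)

Section Median.
Context {R : realType} {n : nat}.
Implicit Types (P Q : pred 'I_n) (f g : 'I_n -> R).

(** Signed votes turn majorities into signs of sums, which can be weighted by displacements and
    compared with costs. *)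
Definition vote (b : bool) : R := if b then 1 else -1.

Lemma sum_vote P : \sum_i vote (P i) = 2 * #|P|%:R - n%:R.
Proof.
transitivity (\sum_(i < n) (2 * (P i)%:R - 1) : R).
  by apply: eq_bigr => i _; rewrite /vote; case: (P i) => /=; ring.
rewrite sumrB -mulr_sumr sumr_const card_ord; congr (2 * _ - _).
rewrite -sum1_card natr_sum [RHS]big_mkcond/=.
by apply: eq_bigr => i _; rewrite unfold_in; case: (P i).
Qed.

Lemma ler_vote (b c : bool) : (b -> c) -> vote b <= vote c.
Proof. by case: b => [/(_ isT) ->//|_]; rewrite /vote; case: c; lra. Qed.

Lemma ler_sum_vote P Q : (forall i, P i -> Q i) ->
  \sum_i vote (P i) <= \sum_i vote (Q i).
Proof. by move=> PQ; apply: ler_sum => i _; exact: ler_vote (PQ i). Qed.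

Lemma count_codom f (a : pred R) : count a (codom f) = #|[pred i | a (f i)]|.
Proof. by rewrite cardE /enum_mem size_filter count_map enumT. Qed.

Hypothesis n0 : (0 < n)%N.

(** For even [n] the median is the lower one, so half of the agents suffice here, whereas
    [median_ge] takes a strict majority. *)
Lemma median_le f c : (median f <= c) = (0 <= \sum_i vote (f i <= c)).
Proof.
rewrite (sum_vote (fun i => f i <= c)) subr_ge0 -natrM ler_nat.
rewrite -(count_codom f (fun y => y <= c)) -(count_sort <=%R) /median.
have ss : sorted <=%R (sort <=%R (codom f)) by exact: sort_le_sorted.
set k := count _ _; have -> : (n <= 2 * k)%N = ((n.+1)./2.-1 < k)%N by lia.
apply/idP/idP => [|/(nth_count_le 0 ss)//].
apply: contraTltn => h; rewrite -ltNge nth_count_gt// h/=.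
by rewrite size_sort size_codom card_ord; lia.
Qed.

Lemma median_ge f c : (c <= median f) = (0 < \sum_i vote (c <= f i)).
Proof.
rewrite (sum_vote (fun i => c <= f i)) subr_gt0 -natrM ltr_nat.
rewrite -(count_codom f (fun y => c <= y)) -(count_sort <=%R) /median.
have ss : sorted <=%R (sort <=%R (codom f)) by exact: sort_le_sorted.
set t := sort _ _ in ss *; have st : size t = n.
  by rewrite size_sort size_codom card_ord.
set k := count _ t.
have kn : (k <= n)%N by rewrite -st count_size.
have h : count (< c) t = (n - k)%N by rewrite count_lt_ge st.
have -> : (n < 2 * k)%N = (count (< c) t <= (n.+1)./2.-1)%N by lia.
apply/idP/idP => [|l]; last by rewrite nth_count_ge// l st; lia.
by apply: contraTleq => l; rewrite -ltNge nth_count_lt.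
Qed.

(** Agents with [g i <= median g] also have [f i <= median g + d], so the vote carries over. *)
Lemma median_lip f g d : (forall i, `|f i - g i| <= d) ->
  `|median f - median g| <= d.
Proof.
have half f' g' : (forall i, f' i <= g' i + d) -> median f' <= median g' + d.
  move=> fg; rewrite median_le; have := lexx (median g'); rewrite median_le.
  move=> /le_trans; apply; apply: ler_sum_vote => i gi.
  by rewrite (le_trans (fg i))// lerD2r.
move=> fg; rewrite ler_norml.
have /half : forall i, f i <= g i + d by move=> i; have := fg i; rewrite ler_norml; lra.
have /half : forall i, g i <= f i + d by move=> i; have := fg i; rewrite ler_norml; lra.
lra.
Qed.

(** Reflection does not preserve the lower median for even [n]. This bound, and the strict majority
    in the next lemma, are valid for both orientations. *)
Lemma median_majority (s : bool) f :
  0 <= \sum_i vote ((-1) ^+ s * median f <= (-1) ^+ s * f i).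
Proof.
case: s.
  have := lexx (median f); rewrite median_le => /le_trans; apply.
  by apply: ler_sum_vote => i; rewrite expr1 !mulN1r lerN2.
have := lexx (median f); rewrite median_ge => /ltW/le_trans; apply.
by apply: ler_sum_vote => i; rewrite expr0 !mul1r.
Qed.

Lemma median_strict_majority (s : bool) f x :
  0 < \sum_i vote ((-1) ^+ s * f i <= (-1) ^+ s * x) ->
  (-1) ^+ s * median f <= (-1) ^+ s * x.
Proof.
case: s => h.
  rewrite expr1 !mulN1r lerN2 median_ge (lt_le_trans h)//.
  by apply: ler_sum_vote => i; rewrite expr1 !mulN1r lerN2.
rewrite expr0 !mul1r median_le (le_trans (ltW h))//.
by apply: ler_sum_vote => i; rewrite expr0 !mul1r.
Qed.

End Median.

(** * Half diamonds and cost changes of a single agent *)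

Ltac split_norms :=
  repeat match goal with |- context [ `| ?x | ] => case: (ger0P x) => ? end.

Ltac split_ifs := repeat
  match goal with |- context [if ?b then _ else _] =>
    match b with context [?x <= ?y] => case: (leP x y) => ? /= end end.

Section HalfDiamond.
Context {R : realType}.
Implicit Types (p q : bool) (u w b a c t : R).

(** Common form of [vEHD] and [hEHD]: it bulges along the coordinate [u], in the positive direction
    if [p] holds; [w] is the other coordinate. *)
Definition half_diamond p u w b c : R :=
  if p then u + Num.max (b - `|c - w|) 0 else u - Num.max (b - `|c - w|) 0.

Lemma half_diamond_lip p u w b c t :
  `|half_diamond p u w b c - half_diamond p u w b t| <= `|c - t|.
Proof.
rewrite /half_diamond /Num.max !ltrBlDr !add0r.
case: p; case: (ltP b `|c - w|); case: (ltP b `|t - w|).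
all: case: (ger0P (c - w)); case: (ger0P (t - w)); case: (ger0P (c - t)).
all: by move=> *; rewrite ler_norml; lra.
Qed.

(** Reflecting the bulging coordinate flips the orientation; reflecting the other one preserves
    [|c - w|]. *)
Lemma half_diamond_sign (s s' p : bool) u w b c m m' :
  half_diamond (p (+) s) ((-1) ^+ s * (u - m)) ((-1) ^+ s' * (w - m')) b
    ((-1) ^+ s' * (c - m')) = (-1) ^+ s * (half_diamond p u w b c - m).
Proof.
rewrite /half_diamond -mulrBr normrM normrX normrN1 expr1n mul1r.
rewrite (_ : c - m' - (w - m') = c - w); last by ring.
by case: s; case: p => /=; ring.
Qed.

(** The vertical rays at [u <= 0 < a] fall short of [a], so only the diamond can reach it. *)
Lemma half_diamond_geT u w b a c : u <= 0 -> 0 < a ->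
  (a <= half_diamond true u w b c) = (`|u - a| + `|w - c| <= b).
Proof.
move=> u0 a0; rewrite /half_diamond (distrC c) [`|u - a|]ler0_norm; last by lra.
by rewrite /Num.max; case: ltP => ?; apply/idP/idP => ?; lra.
Qed.

Lemma half_diamond_geF u w b a c :
  (a <= half_diamond false u w b c) = (a <= u) && (b <= `|u - a| + `|w - c|).
Proof.
rewrite /half_diamond (distrC c) /Num.max; have := normr_ge0 (w - c).
by case: ltP => ?; case: (ger0P (u - a)) => *; apply/idP/andP; [split| |split| |split| |split|]; lra.
Qed.

(** The half diamond opens towards the origin, where med is placed. Both cases admit [u = 0], since
    reflection flips the orientation of an agent level with med. *)
Definition side p u := if p then u <= 0 else 0 <= u.

Lemma sideT u : side true u -> u <= 0. Proof. by []. Qed.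

Lemma sideF u : side false u -> 0 <= u. Proof. by []. Qed.

(** A positive vote means that the point is in the ball and the origin is nearer to the agent by
    [c], or that it is not in the interior and the origin is farther by [c]. Otherwise the triangle
    inequality bounds the gain by [c]. *)
Lemma axis_change q u w b c : side q w -> 0 < c ->
  `| `|u| + `|w - c| - b | + vote (c <= half_diamond q w u b 0) * c <=
  `| `|u| + `|w| - b |.
Proof.
move=> + c0; case: q => [/sideT|/sideF] w0.
  rewrite half_diamond_geT// subr0 [`|w - c|]ler0_norm; last by lra.
  rewrite [`|w|]ler0_norm// /vote; have := normr_ge0 u; set v : R := `|u|; clearbody v => v0.
  by split_ifs; split_norms; lra.
rewrite half_diamond_geF// subr0 [`|w|]ger0_norm// /vote.
have := normr_ge0 u; set v : R := `|u|; clearbody v => v0.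
case: (ger0P (w - c)) => ?; split_ifs.
all: split_norms; lra.
Qed.

(** Here [d] and [e] are the agent's distances to the point and to the origin; a negative [s] bounds
    a gain. *)
Lemma inside_change (d e b s : R) :
  d <= b -> e + s <= d -> `|d - b| + s <= `|e - b|.
Proof.
by move=> db ed; rewrite ler0_norm; have := ler_norm (- (e - b)); rewrite ?normrN; lra.
Qed.

Lemma outside_change (d e b s : R) :
  b <= d -> d + s <= e -> `|d - b| + s <= `|e - b|.
Proof. by move=> db ed; rewrite ger0_norm; have := ler_norm (e - b); lra. Qed.

(** The two coordinates add up unless the half diamonds have opposite orientations and both votes
    are positive: then the two distance changes have opposite signs and partly cancel. *)
Lemma diagonal_change p q u w b a c :
  let A := a <= half_diamond p u w b c in
  let B := c <= half_diamond q w u b a in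
  side p u -> side q w -> 0 < a -> 0 < c ->
  `| `|u - a| + `|w - c| - b | +
    (if [&& A, B & p (+) q] then `|a - c| else vote A * a + vote B * c) <=
  `| `|u| + `|w| - b |.
Proof.
move=> A B + + a0 c0; rewrite /A /B /vote {A B}.
have := ler_normB u a; have := ler_normD (u - a) a.
have := ler_normB w c; have := ler_normD (w - c) c.
rewrite !subrK (gtr0_norm a0) (gtr0_norm c0) => y1 y2 x1 x2.
case: p; case: q.
- move=> /sideT u0 /sideT w0; rewrite !half_diamond_geT// [_ + `|u - a|]addrC !andbF.
  have -> : `|u| = `|u - a| - a by rewrite !ler0_norm; lra.
  have -> : `|w| = `|w - c| - c by rewrite !ler0_norm; lra.
  by case: (leP (_ + _) b) => ?; [apply: inside_change|apply: outside_change]; lra.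
- move=> /sideT u0 /sideF w0.
  rewrite half_diamond_geT// half_diamond_geF [`|w - c| + `|u - a|]addrC andbT.
  have Eu : `|u| = `|u - a| - a by rewrite !ler0_norm; lra.
  have Ew : c <= w -> `|w| = `|w - c| + c by move=> ?; rewrite !ger0_norm; lra.
  case: (leP _ b) => D1; case: (leP c w) => [/Ew Ew'|wc] /=.
  - case: (leP b _) => D2; last by apply: inside_change; lra.
    (* In the ball but not in its interior: the agent pays nothing at [(a, c)] and [|c - a|] at the
       origin. *)
    have -> : `|u - a| + `|w - c| = b by lra.
    have -> : `|u| + `|w| - b = c - a by lra.
    by rewrite subrr normr0 add0r distrC.
  - by apply: inside_change; lra.
  - by rewrite (ltW D1); apply: outside_change; lra.
  - by apply: outside_change; lra.
- move=> /sideF u0 /sideT w0.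
  rewrite half_diamond_geT// half_diamond_geF [`|w - c| + `|u - a|]addrC andbT.
  have Ew : `|w| = `|w - c| - c by rewrite !ler0_norm; lra.
  have Eu : a <= u -> `|u| = `|u - a| + a by move=> ?; rewrite !ger0_norm; lra.
  case: (leP _ b) => D1; case: (leP a u) => [/Eu Eu'|ua] /=.
  - case: (leP b _) => D2; last by apply: inside_change; lra.
    have -> : `|u - a| + `|w - c| = b by lra.
    have -> : `|u| + `|w| - b = a - c by lra.
    by rewrite subrr normr0 add0r.
  - by apply: inside_change; lra.
  - by rewrite (ltW D1); apply: outside_change; lra.
  - by apply: outside_change; lra.
- move=> /sideF u0 /sideF w0.
  rewrite !half_diamond_geF [`|w - c| + `|u - a|]addrC !andbF.
  have Ew : c <= w -> `|w| = `|w - c| + c by move=> ?; rewrite !ger0_norm; lra.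
  have Eu : a <= u -> `|u| = `|u - a| + a by move=> ?; rewrite !ger0_norm; lra.
  case: (leP b _) => D1; last by rewrite !andbF; apply: inside_change; lra.
  case: (leP c w) => [/Ew Ew'|wc]; case: (leP a u) => [/Eu Eu'|ua] /=.
  - by apply: outside_change; lra.
  - by apply: outside_change; lra.
  - by apply: outside_change; lra.
  - by apply: outside_change; lra.
Qed.

(* A tied half diamond overlaps the other one of the same agent along an edge
   of slope 1 through (a, c). *)
Lemma tied_diagonal p q u w b a c t :
  side p u -> side q w -> 0 < a -> 0 < c ->
  [&& a <= half_diamond p u w b c, c <= half_diamond q w u b a & p (+) q] ->
  0 <= t -> t <= a -> t <= c ->
  half_diamond p u w b (c - t) <= a - t /\ half_diamond q w u b (a - t) <= c - t.
Proof.
move=> su sw a0 c0 /and3P[A B pq]; move: pq su sw A B; case: p; case: q => // _.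
  move=> /sideT u0 /sideF w0; rewrite half_diamond_geT// half_diamond_geF.
  move=> h1 /andP[h2 h3] t0 ta tc; move: h1 h3; rewrite /half_diamond.
  rewrite (@ler0_norm _ (u - a)) ?(@ger0_norm _ (w - c)); [|lra..].
  rewrite (@ler0_norm _ (c - t - w)) ?(@ger0_norm _ (a - t - u)); [|lra..].
  rewrite /Num.max; case: (ltP _ 0) => ?; case: (ltP _ 0) => ?; lra.
move=> /sideF u0 /sideT w0; rewrite half_diamond_geT// half_diamond_geF.
move=> /andP[h2 h3] h1 t0 ta tc; move: h1 h3; rewrite /half_diamond.
rewrite (@ger0_norm _ (u - a)) ?(@ler0_norm _ (w - c)); [|lra..].
rewrite (@ger0_norm _ (c - t - w)) ?(@ler0_norm _ (a - t - u)); [|lra..].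
rewrite /Num.max; case: (ltP _ 0) => ?; case: (ltP _ 0) => ?; lra.
Qed.

End HalfDiamond.

(** * Summing the changes over all agents *)

Section Agents.
Context {R : realType} {n : nat}.
Implicit Types (p q : pred 'I_n) (u w b : 'I_n -> R) (a c t : R).
Local Notation vote := (@vote R).

Lemma finite_lower_bound (f : 'I_n -> R) : (forall i, 0 < f i) ->
  exists2 e, 0 < e & forall i, e <= f i.
Proof.
move=> f0; exists (\big[Num.min/1]_i f i); first by exact: lt_bigmin.
by move=> i; exact: bigmin_le_cond.
Qed.

Lemma axis_total q u w b c : (forall i, side (q i) (w i)) -> 0 < c ->
  0 <= \sum_i vote (c <= half_diamond (q i) (w i) (u i) (b i) 0) ->
  \sum_i `| `|u i| + `|w i - c| - b i| <= \sum_i `| `|u i| + `|w i| - b i|.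
Proof.
move=> qw c0 /(@mulr_ge0 R)/(_ (ltW c0)) h.
apply: (@le_trans _ _ (\sum_i (`| `|u i| + `|w i - c| - b i| +
    vote (c <= half_diamond (q i) (w i) (u i) (b i) 0) * c))).
  by rewrite big_split/= -mulr_suml lerDl.
by apply: ler_sum => i _; exact: axis_change.
Qed.

(* [x + y - k] is the vote balance of both coordinates with the tied agents left
   out; when it is negative, the tied agents and those short of (a, c) form a
   strict majority in each coordinate. *)
Lemma diagonal_total p q u w b a c :
  (forall i, side (p i) (u i)) -> (forall i, side (q i) (w i)) ->
  0 < a -> 0 < c ->
  0 <= \sum_i vote (a <= half_diamond (p i) (u i) (w i) (b i) c) ->
  0 <= \sum_i vote (c <= half_diamond (q i) (w i) (u i) (b i) a) ->
  \sum_i `| `|u i - a| + `|w i - c| - b i| <= \sum_i `| `|u i| + `|w i| - b i|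
  \/ exists t, [/\ 0 < t, t <= a, t <= c,
    0 < \sum_i vote (half_diamond (p i) (u i) (w i) (b i) (c - t) <= a - t) &
    0 < \sum_i vote (half_diamond (q i) (w i) (u i) (b i) (a - t) <= c - t)].
Proof.
move=> pu qw a0 c0.
pose A i := a <= half_diamond (p i) (u i) (w i) (b i) c.
pose B i := c <= half_diamond (q i) (w i) (u i) (b i) a.
pose T i : R := [&& A i, B i & p i (+) q i]%:R.
rewrite -/(\sum_i vote (A i)) -/(\sum_i vote (B i)).
set x := \sum_i vote (A i); set y := \sum_i vote (B i) => x0 y0.
pose k := \sum_i (2 * T i).
have [xyk|xyk] := leP 0 (x + y - k); [left|right].
  (* If [c <= a], the bounds of [diagonal_change] regroup into weight [a - c] on the first vote and
     weight [c] on the tie-corrected balance; both totals are nonnegative. The other case is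
     symmetric. *)
  have [ca|ac] := leP c a.
    apply: (@le_trans _ _ (\sum_i (`| `|u i - a| + `|w i - c| - b i| +
      (vote (A i) * (a - c) + (vote (A i) + vote (B i) - 2 * T i) * c)))).
      rewrite big_split/= lerDl big_split/= -!mulr_suml sumrB big_split/=.
      by rewrite addr_ge0// mulr_ge0// ?subr_ge0// ltW.
    apply: ler_sum => i _.
    have := diagonal_change (p i) (q i) (u i) (w i) (b i) a c (pu i) (qw i) a0 c0.
    apply: le_trans; rewrite lerD2l /T -/(A i) -/(B i) /vote.
    case: (A i); case: (B i); case: (_ (+) _) => /=; rewrite ?ger0_norm; lra.
  apply: (@le_trans _ _ (\sum_i (`| `|u i - a| + `|w i - c| - b i| +
    (vote (B i) * (c - a) + (vote (A i) + vote (B i) - 2 * T i) * a)))).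
    rewrite big_split/= lerDl big_split/= -!mulr_suml sumrB big_split/=.
    by rewrite addr_ge0// mulr_ge0// ?subr_ge0// ltW.
  apply: ler_sum => i _.
  have := diagonal_change (p i) (q i) (u i) (w i) (b i) a c (pu i) (qw i) a0 c0.
  apply: le_trans; rewrite lerD2l /T -/(A i) -/(B i) /vote.
  case: (A i); case: (B i); case: (_ (+) _) => /=; rewrite ?ltr0_norm; lra.
(* The half diamond of an agent short of the point rises by at most [t] while the target drops by
   [t], so [t] may be half the gap; 1 is a placeholder for the other agents. *)
have slack p' u' w' a' c' : exists2 e, 0 < e & forall i t, 0 <= t -> t <= e ->
    ~~ (a' <= half_diamond (p' i) (u' i) (w' i) (b i) c') ->
    half_diamond (p' i) (u' i) (w' i) (b i) (c' - t) <= a' - t.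
  pose f i := half_diamond (p' i) (u' i) (w' i) (b i) c'.
  have [i|e e0 ef] :=
    finite_lower_bound (fun i => if a' <= f i then 1 else (a' - f i) / 2).
    by rewrite /=; case: ifP => // /negbT; rewrite -ltNge => fa; lra.
  exists e => // i t t0 te; rewrite -/(f i) -ltNge => fa; have := ef i.
  rewrite /= [a' <= _]leNgt fa /= => ei.
  have := half_diamond_lip (p' i) (u' i) (w' i) (b i) (c' - t) c'.
  rewrite -/(f i) (_ : c' - t - c' = - t) ?normrN ?(ger0_norm t0); last by ring.
  by rewrite ler_norml; lra.
have [e e0 eP] := slack p u w a c; have [e' e'0 e'P] := slack q w u c a.
(* The bounds [a] and [c] keep the move from passing the origin. *)
pose t := Num.min (Num.min a c) (Num.min e e').
have t0 : 0 < t by rewrite !lt_min a0 c0 e0 e'0.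
have := lexx t; rewrite {2}/t !le_min => /andP[/andP[ta tc] /andP[te te']].
(* Each term [2 * T i - vote (P i)] is 1 for tied agents and those outside [P], and -1 for the rest.
   The sum is positive for [A] and [B] because [x + y < k] with [x, y >= 0]. *)
have win (P Q : pred 'I_n) : 0 < k - \sum_i vote (P i) ->
    (forall i, [&& A i, B i & p i (+) q i] || ~~ P i -> Q i) ->
    (forall i, [&& A i, B i & p i (+) q i] -> P i) ->
    0 < \sum_i vote (Q i).
  move=> kP PQ TP; apply: (lt_le_trans kP); rewrite -sumrB; apply: ler_sum => i _.
  rewrite /T; have := PQ i; have := TP i; rewrite /vote.
  case: [&& _, _ & _] => /= [/(_ isT) -> /(_ isT) ->|_]; first by lra.
  by case: (P i) => /= [_|/(_ isT) ->]; [case: (Q i)|]; lra.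
have tie i : [&& A i, B i & p i (+) q i] ->
    half_diamond (p i) (u i) (w i) (b i) (c - t) <= a - t /\
    half_diamond (q i) (w i) (u i) (b i) (a - t) <= c - t.
  by move=> Ti; apply: tied_diagonal => //; exact: ltW.
exists t; split => //.
- apply: (win A) => [|i /orP[/tie[]//|]|i /and3P[]//]; first by rewrite -/x; lra.
  exact: eP (ltW t0) te.
- apply: (win B) => [|i /orP[/tie[]//|]|i /and3P[]//]; first by rewrite -/y; lra.
  exact: e'P (ltW t0) te'.
Qed.

End Agents.

(** * Split lines as Lipschitz graphs and their crossings *)

Section SplitLines.
Context {R : realType} {n : nat}.
Variable I : instance R n.
Hypothesis n0 : (0 < n)%N.

Definition vsplit (y : R) : R := median (fun i => vEHD I i y).
Definition hsplit (x : R) : R := median (fun i => hEHD I i x).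

Lemma vsplit_lip s t : `|vsplit s - vsplit t| <= `|s - t|.
Proof. by apply: median_lip => // i; exact: half_diamond_lip. Qed.

Lemma hsplit_lip s t : `|hsplit s - hsplit t| <= `|s - t|.
Proof. by apply: median_lip => // i; exact: half_diamond_lip. Qed.

Lemma crossing x y :
  (vsplit_line I `&` hsplit_line I) (x, y) <-> vsplit y = x /\ hsplit x = y.
Proof.
split=> [[[t _ [<- <-]] [s _ [h1 h2]]]|[h1 h2]].
  by split=> //; rewrite /vsplit -h1.
by split; [exists y => //; rewrite -h1|exists x => //; rewrite -h2].
Qed.

Lemma lipschitz_continuous (f : R -> R) (k : R) :
  (forall s t, `|f s - f t| <= k * `|s - t|) -> continuous f.
Proof.
move=> fk x; apply/cvgrPdist_le => e e0; near=> t.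
rewrite (le_trans (fk _ _))//.
have : `|x - t| <= e / (`|k| + 1).
  near: t; apply: cvgr_dist_le; first exact: cvg_id.
  by rewrite divr_gt0// ltr_wpDl.
rewrite ler_pdivlMr ?ltr_wpDl// mulrDr mulr1 => h.
have := ler_wpM2r (normr_ge0 (x - t)) (ler_norm k).
have := normr_ge0 (x - t); rewrite mulrC in h; lra.
Unshelve. all: by end_near. Qed.

(** Crossings are the fixed points of [vsplit] after [hsplit]; those no farther from med than [z]
    all lie in a compact set [K] of fixed points. *)
Lemma nearest_crossing z : (vsplit_line I `&` hsplit_line I) z ->
  exists x, vsplit (hsplit x) = x /\ forall x', vsplit (hsplit x') = x' ->
    dist1 (x, hsplit x) (med I) <= dist1 (x', hsplit x') (med I).
Proof.
case: z => x0 y0 /crossing[+ y0E]; rewrite -{}y0E => x0E.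
pose d x := dist1 (x, hsplit x) (med I).
have dx x : `|x - (med I).1| <= d x by rewrite /d /dist1 lerDl.
pose m := (med I).1.
pose K := `[m - d x0, m + d x0] `&` [set x | vsplit (hsplit x) - x = 0].
have g_cont : continuous (fun x => vsplit (hsplit x) - x).
  apply: (@lipschitz_continuous _ 2) => s t.
  rewrite (_ : _ - _ = (vsplit (hsplit s) - vsplit (hsplit t)) - (s - t)); last by ring.
  rewrite (le_trans (ler_normB _ _))// mulr_natl mulr2n lerD2r.
  exact: le_trans (vsplit_lip _ _) (hsplit_lip _ _).
have d_cont : continuous d.
  apply: (@lipschitz_continuous _ 2) => s t.
  rewrite /d /dist1 /= opprD addrACA (le_trans (ler_normD _ _))// mulr_natl mulr2n.
  have shift (e f g : R) : `| `|e - g| - `|f - g| | <= `|e - f|.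
    by rewrite (le_trans (ler_dist_dist _ _))// opprB addrA subrK.
  by rewrite lerD// (le_trans (shift _ _ _))// hsplit_lip.
have cK : compact K.
  apply: compact_closedI; first exact: segment_compact.
  by apply: (preimage_closed _ (@closed_eq _ 0)) => x _; exact: g_cont.
have inK x : vsplit (hsplit x) = x -> d x <= d x0 -> K x.
  move=> xE dxx; split; rewrite /= ?in_itv/= ?xE ?subrr//.
  by have := le_trans (dx x) dxx; rewrite -/m ler_norml; lra.
have [|x xK xmin] := compact_EVT_min _ cK (continuous_subspaceT d_cont).
  by exists x0; exact: inK.
have [_ /eqP] := set_mem xK; rewrite subr_eq0 => /eqP xE.
exists x; split=> // x' x'E; have [h|/ltW h] := leP (d x') (d x0).
  by apply: xmin; rewrite inE; exact: inK.
by apply: le_trans h; apply: xmin; rewrite inE; exact: inK.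
Qed.

End SplitLines.

(** * Comparing a nearest crossing with med *)

Lemma side_sign {R : realType} (s : bool) (x m : R) :
  side ((x <= m) (+) s) ((-1) ^+ s * (x - m)).
Proof.
by rewrite /side; case: s; case: leP => /=; rewrite ?expr0 ?expr1 => ?; lra.
Qed.

Lemma nearest_crossing_le_med {R : realType} {n : nat} (I : instance R n) x :
  (0 < n)%N -> vsplit I (hsplit I x) = x ->
  (forall x', vsplit I (hsplit I x') = x' ->
    dist1 (x, hsplit I x) (med I) <= dist1 (x', hsplit I x') (med I)) ->
  SC I (x, hsplit I x) <= SC I (med I).
Proof.
move=> n0; move yE : (hsplit I x) => y xE xmin.
pose m := (med I).1; pose m' := (med I).2.
pose s := x < m; pose s' := y < m'.
pose a := (-1) ^+ s * (x - m); pose c := (-1) ^+ s' * (y - m').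
pose u i := (-1) ^+ s * (loc_x I i - m).
pose w i := (-1) ^+ s' * (loc_y I i - m').
pose p i := (loc_x I i <= m) (+) s; pose q i := (loc_y I i <= m') (+) s'.
have pu i : side (p i) (u i) by exact: side_sign.
have qw i : side (q i) (w i) by exact: side_sign.
have vE i y' : half_diamond (p i) (u i) (w i) (pref I i) ((-1) ^+ s' * (y' - m')) =
    (-1) ^+ s * (vEHD I i y' - m) by exact: half_diamond_sign.
have hE i x' : half_diamond (q i) (w i) (u i) (pref I i) ((-1) ^+ s * (x' - m)) =
    (-1) ^+ s' * (hEHD I i x' - m') by exact: half_diamond_sign.
have subB (e f g : R) : e - g - (f - g) = e - f by ring.
have norm_sign (r : bool) (e : R) : `|(-1) ^+ r * e| = `|e|.
  by rewrite normrM normrX normrN1 expr1n mul1r.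
have a_ge0 : 0 <= a by rewrite /a /s; case: ltP => /=; rewrite ?expr0 ?expr1; lra.
have c_ge0 : 0 <= c by rewrite /c /s'; case: ltP => /=; rewrite ?expr0 ?expr1; lra.
have SCz : SC I (x, y) = \sum_i `| `|u i - a| + `|w i - c| - pref I i|.
  apply: eq_bigr => i _; rewrite /cost /dist1 /u /w /a /c -!mulrBr !norm_sign /=.
  by rewrite !subB.
have SCm : SC I (med I) = \sum_i `| `|u i| + `|w i| - pref I i|.
  by apply: eq_bigr => i _; rewrite /cost /dist1 /u /w !norm_sign.
have Va : 0 <= \sum_i @vote R (a <= half_diamond (p i) (u i) (w i) (pref I i) c).
  apply: le_trans (median_majority n0 s (fun i => vEHD I i y)) _.
  by apply: ler_sum_vote => i; rewrite vE -/(vsplit I y) xE /a !mulrBr lerD2r.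
have Hc : 0 <= \sum_i @vote R (c <= half_diamond (q i) (w i) (u i) (pref I i) a).
  apply: le_trans (median_majority n0 s' (fun i => hEHD I i x)) _.
  by apply: ler_sum_vote => i; rewrite hE -/(hsplit I x) yE /c !mulrBr lerD2r.
rewrite SCz SCm.
(* If the crossing shares a coordinate with med, the votes in the other coordinate decide and no
   ties arise. *)
have [a0|a0] := eqVneq a 0.
  rewrite a0 in Hc *.
  under eq_bigr do rewrite subr0.
  have [c0|c0] := eqVneq c 0; first by under eq_bigr do rewrite c0 subr0.
  by apply: (axis_total q u w (pref I) c qw _ Hc); rewrite lt_def c0.
have [c0|c0] := eqVneq c 0.
  rewrite c0 in Va *.
  under eq_bigr do rewrite subr0 [`|u _ - a| + _]addrC.
  under [leRHS]eq_bigr do rewrite [`|u _| + _]addrC.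
  by apply: (axis_total p w u (pref I) a pu _ Va); rewrite lt_def a0.
have {}a0 : 0 < a by rewrite lt_def a0.
have {}c0 : 0 < c by rewrite lt_def c0.
have [//|[t [t0 ta tc Vt Ht]]] := diagonal_total p q u w (pref I) a c pu qw a0 c0 Va Hc.
pose x' := x - (-1) ^+ s * t; pose y' := y - (-1) ^+ s' * t.
have sq (r : bool) (e : R) : (-1) ^+ r * ((-1) ^+ r * e) = e.
  by rewrite mulrA -expr2 sqrr_sign mul1r.
have x'E : (-1) ^+ s * (x' - m) = a - t.
  by rewrite /x' (_ : _ - _ - m = x - m - (-1) ^+ s * t) ?mulrBr ?sq// -?mulrBr//; ring.
have y'E : (-1) ^+ s' * (y' - m') = c - t.
  by rewrite /y' (_ : _ - _ - m' = y - m' - (-1) ^+ s' * t) ?mulrBr ?sq// -?mulrBr//; ring.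
(* The Lipschitz bound allows a split line to shift by at most [t], and the strict majority forces
   at least [t] towards med, so it shifts by exactly [t]. *)
have pin (r : bool) (e f : R) : `|f - e| <= t ->
    (-1) ^+ r * f <= (-1) ^+ r * (e - (-1) ^+ r * t) -> f = e - (-1) ^+ r * t.
  rewrite ler_norml => /andP[h1 h2] h3; apply/eqP; rewrite eq_le; move: h3.
  by case: r; rewrite ?expr0 ?expr1 => h3; apply/andP; split; lra.
have Vx' : vsplit I y' = x'.
  apply: pin; first last.
    apply: median_strict_majority => //; apply: lt_le_trans Vt _.
    by apply: ler_sum_vote => i; rewrite -y'E vE -x'E !mulrBr lerD2r.
  rewrite -xE (le_trans (vsplit_lip _ n0 _ _))// /y'.
  by rewrite addrAC subrr add0r normrN norm_sign gtr0_norm.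
have Hy' : hsplit I x' = y'.
  apply: pin; first last.
    apply: median_strict_majority => //; apply: lt_le_trans Ht _.
    by apply: ler_sum_vote => i; rewrite -x'E hE -y'E !mulrBr lerD2r.
  rewrite -yE (le_trans (hsplit_lip _ n0 _ _))// /x'.
  by rewrite addrAC subrr add0r normrN norm_sign gtr0_norm.
(* The crossing [(x', y')] is nearer to med by [2 * t], contradicting minimality. *)
have := xmin x'; rewrite Hy' => /(_ Vx').
rewrite /dist1 /= -/m -/m' -(norm_sign s (x - m)) -(norm_sign s' (y - m')).
rewrite -(norm_sign s (x' - m)) -(norm_sign s' (y' - m')) x'E y'E -/a -/c.
by rewrite !ger0_norm ?subr_ge0//; lra.
Qed.

Theorem lemma11 (R : realType) (B : R) (n : nat) (n_ge1 : (1 <= n)%N)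
    (I : instance R n) (pref_bounds : forall i : 'I_n, 0 <= pref I i <= B)
    (med_plus : R * R) (med_plusP : is_med_plus I med_plus) :
  SC I med_plus <= SC I (med I).
Proof.
have [zS zmin _] := med_plusP.
have [x [xE xmin]] := nearest_crossing I n_ge1 med_plus zS.
apply: le_trans (nearest_crossing_le_med I x n_ge1 xE xmin).
by apply: zmin; apply/crossing.
Qed.
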